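(* Let $t\ge1$, let $d_1,\dots,d_t$ be positive integers and $h_1,\dots,h_t$ nonnegative integers, put $n=\sum_{i=1}^t d_i$, and assume $h_1+\cdots+h_t\le n$. Let $B=B(h_1,d_1;\dots;h_t,d_t)$ be the Ferrers board in the $n\times n$ grid whose first $d_1$ columns have height $h_1$, whose next $d_2$ columns have height $h_1+h_2$, and so on, the last $d_t$ columns having height $h_1+\cdots+h_t$. Then $\mathrm{mat}(\,\cdot\,,B)$ is multiset Mahonian, i.e., with $\mathbf d=(d_1,\dots,d_t)$, $$\sum_{\sigma\in M(\mathbf d)} q^{\mathrm{mat}(\sigma,B)}=\frac{[n]!}{\prod_{i=1}^t[d_i]!}.$$
   Context: $[m]=(1-q^m)/(1-q)$, $[m]!=\prod_{i=1}^m[i]$. Squares of the $n\times n$ grid are labelled $(i,j)$ = (row, column) as for a matrix (row $1$ at the top, column $1$ at the left). A column of a Ferrers board of height $c$ consists of the top $c$ squares of that column. $\mathrm{Area}(B)$ is the number of squares of $B$. $M(\mathbf d)$ is the set of permutations (linear arrangements) $\sigma=\sigma_1\cdots\sigma_n$ of the multiset $\{1^{d_1}2^{d_2}\cdots t^{d_t}\}$. Non-attacking means no two rooks share a row or a column. For a placement $C$ of $n$ non-attacking rooks on the $n\times n$ grid with exactly $k$ rooks on $B$, $\mathrm{cross}(C,B)$ is the number of squares of the grid satisfying at least one of: (i) containing a rook or being to the right of a rook (same row); (ii) being above a rook (same column) and on $B$; (iii) being below (same column) a rook which is off $B$. Put $\mathrm{mat}(C,B)=n(n-k)+\mathrm{Area}(B)-\mathrm{cross}(C,B)$.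 A section $D$ of $B$ of width $d$ is a set of $d$ consecutive columns of the grid in which all columns of $B$ have the same height. If $s$ of the $d$ rooks of $C$ in $D$ are on $B$, then $C$ is $D$-standard if: (1) the $d-s$ rooks in $D$ off $B$ are in the $d-s$ left-most columns of $D$ and are in descending order: if two of them occupy $(i,j)$ and $(k,l)$ with $i<k$, then $j<l$; and (2) the $s$ rooks in $D$ on $B$ are in ascending order: if two of them occupy $(i,j)$ and $(k,l)$ with $i<k$, then $j>l$. Let block $j$ be the set of columns $d_1+\cdots+d_{j-1}+1,\dots,d_1+\cdots+d_j$. For $\sigma\in M(\mathbf d)$, the $B$-standard graph $C(\sigma)$ is the unique placement of $n$ non-attacking rooks on the $n\times n$ grid such that for each $i$ the rook in row $i$ lies in block $\sigma_i$, and which is $D$-standard for $D$ equal to each of the $t$ blocks. Define $\mathrm{mat}(\sigma,B)=\mathrm{mat}(C(\sigma),B)$. *)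

(* Defs.v *)
From HB Require Import structures.
From mathcomp Require Import all_boot all_order all_algebra.

Set Implicit Arguments.
Unset Strict Implicit.
Unset Printing Implicit Defensive.

Import GRing.Theory.

Local Open Scope nat_scope.

(* The indeterminate q, in the field Q(q) of rational functions. *)
Definition qvar : {fraction {poly rat}} := tofrac 'X.

Definition qint (m : nat) : {fraction {poly rat}} :=
  ((1 - qvar ^+ m) / (1 - qvar))%R.

Definition qfact (m : nat) : {fraction {poly rat}} :=
  (\prod_(1 <= i < m.+1) qint i)%R.

(* A square of the n x n grid is a pair (row, column), numbered from 0:
   row 0 is at the top and column 0 at the left. *)
Notation square n := ('I_n * 'I_n)%type.

Definition nonattacking n (C : {set square n}) : bool :=
  [forall x in C, forall y in C, (x != y) ==> (x.1 != y.1) && (x.2 != y.2)].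

Definition placement n (C : {set square n}) : bool :=
  nonattacking C && (#|C| == n).

(* The three clauses are those of "cross", in order. *)
Definition crossed n (C B : {set square n}) : {set square n} :=
  [set x : square n | [|| [exists y in C, (y.1 == x.1) && (y.2 <= x.2)],
               (x \in B) && [exists y in C, (y.2 == x.2) && (x.1 < y.1)]
             | [exists y in C, [&& y \notin B, y.2 == x.2 & y.1 < x.1]]]].

Definition cross n (C B : {set square n}) : nat := #|crossed C B|.

(* mat is int-valued so that neither subtraction is truncated;
   k = #|C :&: B| is the number of rooks on B. *)
Definition mat n (C B : {set square n}) : int :=
  (n%:Z * (n%:Z - #|C :&: B|%:Z) + #|B|%:Z - (cross C B)%:Z)%R.

(* For a set D of consecutive columns. The first conjunct says that the rooks
   off B lie in the d - s left-most columns of D: the number of columns of D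
   to the left of such a rook is less than d - s. *)
Definition D_standard n (B : {set square n}) (D : {set 'I_n})
    (C : {set square n}) : bool :=
  let on := [set x in C | (x.2 \in D) && (x \in B)] in
  let off := [set x in C | (x.2 \in D) && (x \notin B)] in
  [&& [forall x in off, #|[set c in D | c < x.2]| < #|D| - #|on|],
      [forall x in off, forall y in off, (x.1 < y.1) ==> (x.2 < y.2)]
    & [forall x in on, forall y in on, (x.1 < y.1) ==> (y.2 < x.2)]].

Definition block n t (d : 'I_t -> nat) (j : 'I_t) : {set 'I_n} :=
  [set c : 'I_n | \sum_(l < t | l < j) d l <= c < \sum_(l < t | l <= j) d l].
Arguments block : clear implicits.

Definition ferrers n t (h d : 'I_t -> nat) : {set square n} :=
  [set x : square n | [exists j : 'I_t,
    (x.2 \in block n t d j) && (x.1 < \sum_(l < t | l <= j) h l)]].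
Arguments ferrers : clear implicits.

(* The letters 1, ..., t are represented by the elements of 'I_t. *)
Definition multiperm n t (d : 'I_t -> nat) : {set n.-tuple 'I_t} :=
  [set s : n.-tuple 'I_t | [forall j, count_mem j s == d j]].
Arguments multiperm : clear implicits.

Definition is_standard_graph n t (d : 'I_t -> nat) (B : {set square n})
    (s : n.-tuple 'I_t) (C : {set square n}) : bool :=
  [&& placement C,
      [forall x in C, x.2 \in block n t d (tnth s x.1)]
    & [forall j : 'I_t, D_standard B (block n t d j) C]].

(* The default value is never used for s in M(d): see
   standard_graph_exists_unique below. *)
Definition standard_graph n t (d : 'I_t -> nat) (B : {set square n})
    (s : n.-tuple 'I_t) : {set square n} :=
  odflt set0 [pick C | is_standard_graph d B s C].

Definition mat_word n t (d : 'I_t -> nat) (B : {set square n})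
    (s : n.-tuple 'I_t) : int :=
  mat (standard_graph d B s) B.
Lemma card_ord_lt n (b : nat) : b <= n -> #|[set c : 'I_n | c < b]| = b.
Proof.
move=> le_bn; rewrite -sum1dep_card.
by rewrite (big_ord_narrow le_bn) sum1_card card_ord.
Qed.

Lemma card_ord_itv n (a b : nat) : a <= b <= n ->
  #|[set c : 'I_n | a <= c < b]| = b - a.
Proof.
case/andP=> le_ab le_bn.
have -> : [set c : 'I_n | a <= c < b] =
    [set c : 'I_n | c < b] :\: [set c : 'I_n | c < a].
  by apply/setP=> c; rewrite !inE -leqNgt.
rewrite cardsD; have -> : [set c : 'I_n | c < b] :&: [set c : 'I_n | c < a] =
    [set c : 'I_n | c < a].
  apply/setP=> c; rewrite !inE andbC; case: ltnP => //= lt_ca.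
  exact: leq_trans lt_ca le_ab.
by rewrite !card_ord_lt // (leq_trans le_ab).
Qed.

Section StandardGraph.

Variables (n t : nat) (d h : 'I_t -> nat) (s : n.-tuple 'I_t).
Hypotheses (hn : n = \sum_(i < t) d i) (hs : s \in multiperm n t d).

Let S (j : 'I_t) := \sum_(l < t | l < j) d l.
Let H (j : 'I_t) := \sum_(l < t | l <= j) h l.
Let B := ferrers n t h d.
Let D := block n t d.

Let sumS (j : 'I_t) : \sum_(l < t | l <= j) d l = S j + d j.
Proof.
rewrite (bigD1 j) //= addnC; congr (_ + _); apply: eq_bigl => l.
by rewrite [RHS]ltn_neqAle andbC.
Qed.

Let S_le (j : 'I_t) : S j + d j <= n.
Proof. by rewrite -sumS hn [leqRHS](bigID (fun l : 'I_t => l <= j)) leq_addr. Qed.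

Let S_lt (j k : 'I_t) : j < k -> S j + d j <= S k.
Proof.
move=> lt_jk; rewrite -sumS /S [leqRHS](bigID (fun l : 'I_t => l <= j)) /=.
rewrite [X in _ <= X + _](eq_bigl (fun l : 'I_t => l <= j)) ?leq_addr //.
move=> l; rewrite andbC; case: (leqP l j) => //= le_lj.
exact: leq_ltn_trans lt_jk.
Qed.

Let in_D j (c : 'I_n) : (c \in D j) = (S j <= c < S j + d j).
Proof. by rewrite inE sumS. Qed.

Let D_inj j k (c : 'I_n) : c \in D j -> c \in D k -> j = k.
Proof.
rewrite !in_D => /andP[j1 j2] /andP[k1 k2]; apply: val_inj => /=.
case: (ltngtP j k) => // lt; have le := S_lt lt.
- by move: (leq_ltn_trans (leq_trans le k1) j2); rewrite ltnn.
- by move: (leq_ltn_trans (leq_trans le j1) k2); rewrite ltnn.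
Qed.

Let card_D j : #|D j| = d j.
Proof.
rewrite -[RHS](addKn (S j)) -(@card_ord_itv n) ?leq_addr ?S_le //.
by apply: eq_card => c; rewrite in_D inE.
Qed.

Let card_Dlt j (m : nat) : S j <= m <= S j + d j ->
  #|[set c in D j | c < m]| = m - S j.
Proof.
case/andP=> m1 m2; rewrite -(@card_ord_itv n) ?m1 ?(leq_trans m2) //.
apply: eq_card => c; rewrite [LHS]inE in_D inE -andbA; case: (S j <= c) => //=.
by apply/andP/idP=> [[]//|lt]; rewrite lt (leq_trans lt).
Qed.

Let in_B (x : square n) j : x.2 \in D j -> (x \in B) = (x.1 < H j).
Proof.
move=> xD; rewrite inE; apply/existsP/idP => [[k /andP[kD]]|lt].
  by rewrite (D_inj xD kD).
by exists j; rewrite xD.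
Qed.

Let on (i : 'I_n) := i < H (tnth s i).
Let before (k i : 'I_n) := (tnth s k == tnth s i) &&
  (if on i then on k ==> (i < k) else ~~ on k && (k < i)).
Let rank i := #|[set k | before k i]|.

Let before_irr i : before i i = false.
Proof. by rewrite /before ltnn andbF; case: on; rewrite andbF. Qed.

Let before_trans i k l : before i k -> before k l -> before i l.
Proof.
rewrite /before => /andP[/eqP-> +] /andP[-> /=].
case: (on i); case: (on k); case: (on l) => //= a b.
- exact: ltn_trans b a.
- exact: ltn_trans a b.
Qed.

Let before_total i k : tnth s k = tnth s i -> i != k -> before i k || before k i.
Proof.
rewrite /before => -> ik; rewrite eqxx /=.
by case: (on i); case: (on k); rewrite //= -neq_ltn // eq_sym.
Qed.

Let rank_lt k i : before k i -> rank k < rank i.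
Proof.
move=> ki; apply: proper_card; apply/properP; split.
  by apply/subsetP=> l; rewrite !inE => /before_trans; apply.
by exists k; rewrite !inE ?before_irr.
Qed.

Let card_letter j : #|[set i | tnth s i == j]| = d j.
Proof.
move: hs; rewrite inE => /forallP/(_ j)/eqP <-.
rewrite -[tval s in RHS]map_tnth_enum count_map -size_filter cardE enumT.
by congr size; apply: eq_filter => i; rewrite !inE.
Qed.

Let rank_bound i : rank i < d (tnth s i).
Proof.
rewrite -card_letter; apply: proper_card; apply/properP; split.
  by apply/subsetP=> k; rewrite !inE => /andP[].
by exists i; rewrite !inE ?before_irr.
Qed.

Let col_bound i : S (tnth s i) + rank i < n.
Proof. by apply: leq_trans (S_le (tnth s i)); rewrite ltn_add2l. Qed.

Let col i := Ordinal (col_bound i).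
Let C0 : {set square n} := [set (i, col i) | i : 'I_n].

Let col_D i : col i \in D (tnth s i).
Proof. by rewrite in_D leq_addr ltn_add2l rank_bound. Qed.

Let col_inj : injective col.
Proof.
move=> i k e; have eD := col_D i; rewrite e in eD.
have es := D_inj (col_D k) eD; apply/eqP; apply: contraT => ik.
have /eqP := congr1 val e; rewrite /= -es eqn_add2l => /eqP er.
by case/orP: (before_total es ik) => /rank_lt; rewrite er ltnn.
Qed.

Let in_C0 x : (x \in C0) = (x.2 == col x.1).
Proof.
case: x => i c /=; apply/imsetP/eqP => [[k _ [-> ->]]|->] //.
by exists i.
Qed.

Let card_C0 : #|C0| = n.
Proof. by rewrite card_imset ?card_ord // => i k []. Qed.

Let C0_D x j : x \in C0 -> (x.2 \in D j) = (tnth s x.1 == j).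
Proof.
rewrite in_C0 => /eqP->; apply/idP/eqP => [|<-]; last exact: col_D.
exact: D_inj (col_D _).
Qed.

Let on_B (x : square n) j : x.2 \in D j -> tnth s x.1 = j -> (x \in B) = on x.1.
Proof. by move=> xD e; rewrite (in_B xD) /on e. Qed.

Let C0_std : is_standard_graph d B s C0.
Proof.
apply/and3P; split.
- rewrite /placement card_C0 eqxx andbT.
  apply/forall_inP=> x; rewrite in_C0 => /eqP xE.
  apply/forall_inP=> y; rewrite in_C0 => /eqP yE; apply/implyP=> ne.
  have ne1 : x.1 != y.1.
    apply: contra ne => /eqP e; rewrite [x]surjective_pairing xE e -yE.
    by rewrite -surjective_pairing.
  by rewrite ne1 xE yE (inj_eq col_inj).
- by apply/forall_inP=> x xC; rewrite (C0_D _ xC).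
apply/forallP=> j.
have mem (b : bool) x : x \in [set x in C0 | (x.2 \in D j) && ((x \in B) == b)] ->
    [/\ x.2 = col x.1, tnth s x.1 = j & on x.1 = b].
  rewrite inE => /and3P[xC xD /eqP xB]; split.
  - by move: xC; rewrite in_C0 => /eqP.
  - by apply/eqP; rewrite -(C0_D _ xC).
  - by rewrite -(@on_B x j) //; apply/eqP; rewrite -(C0_D _ xC).
have memT x : x \in [set x in C0 | (x.2 \in D j) && (x \in B)] ->
    [/\ x.2 = col x.1, tnth s x.1 = j & on x.1].
  by rewrite inE => xi; apply: (mem true); rewrite inE eqb_id.
have memF x : x \in [set x in C0 | (x.2 \in D j) && (x \notin B)] ->
    [/\ x.2 = col x.1, tnth s x.1 = j & on x.1 = false].
  by rewrite inE => xi; apply: (mem false); rewrite inE eqbF_neg.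
have col_lt i k : tnth s i = j -> tnth s k = j -> before i k -> col i < col k.
  by move=> si sk /rank_lt; rewrite /= si sk ltn_add2l.
apply/and3P; split.
- apply/forall_inP=> x /memF[xE xs xoff].
  rewrite -/(D j) card_Dlt ?card_D; last first.
    by have := col_D x.1; rewrite in_D xs -xE => /andP[-> /ltnW].
  rewrite xE /= xs addKn.
  set on' := [set x in C0 | _].
  have -> : #|on'| = #|[set i | (tnth s i == j) && on i]|.
    rewrite -(@card_in_imset _ _ fst on'); last first.
      move=> [a b] [c e] /memT[/= -> _ _] /memT[/= -> _ _] /= ->; done.
    apply: eq_card => i; rewrite inE; apply/imsetP/idP.
      by case=> y /memT[_ ys yon] ->; rewrite ys yon eqxx.
    case/andP=> is_ ion; exists (i, col i) => //.
    have iC : (i, col i) \in C0 by rewrite in_C0.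
    rewrite inE iC (C0_D _ iC) is_ (@on_B _ j) ?ion ?(C0_D _ iC) //.
    exact/eqP.
  have -> : d j - #|[set i | (tnth s i == j) && on i]| =
            #|[set i | (tnth s i == j) && ~~ on i]|.
    rewrite -card_letter -(cardsID [set i | on i]).
    have -> : [set i | tnth s i == j] :&: [set i | on i] =
              [set i | (tnth s i == j) && on i].
      by apply/setP=> i; rewrite !inE.
    by rewrite addKn; apply: eq_card => i; rewrite !inE andbC.
  apply: proper_card; apply/properP; split.
    apply/subsetP=> i; rewrite !inE /before xoff xs => /andP[-> /=].
    by case/andP.
  by exists x.1; rewrite !inE ?before_irr // xs eqxx xoff.
- apply/forall_inP=> x /memF[xE xs xo]; apply/forall_inP=> y /memF[yE ys yo].
  apply/implyP=> lt; rewrite xE yE; apply: col_lt => //.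
  by rewrite /before xs ys eqxx xo yo.
- apply/forall_inP=> x /memT[xE xs xo]; apply/forall_inP=> y /memT[yE ys yo].
  apply/implyP=> lt; rewrite xE yE; apply: col_lt => //.
  by rewrite /before xs ys eqxx xo yo.
Qed.

Let std_C0 C : is_standard_graph d B s C -> C = C0.
Proof.
case/and3P=> /andP[/forall_inP natt /eqP cardC] /forall_inP blk /forallP std.
have inj1 : {in C &, injective fst}.
  move=> x y xC yC e; apply/eqP; apply: contraT => ne.
  by have /forall_inP/(_ y yC) := natt x xC; rewrite ne e eqxx /=.
have inj2 : {in C &, injective snd}.
  move=> x y xC yC e; apply/eqP; apply: contraT => ne.
  by have /forall_inP/(_ y yC) := natt x xC; rewrite ne e eqxx andbF /=.
have sur1 i : exists2 x, x \in C & i = x.1.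
  apply/imsetP; suff -> : fst @: C = setT by [].
  by apply/eqP; rewrite eqEcard subsetT cardsT card_ord card_in_imset // cardC leqnn.
have sur2 i : exists2 x, x \in C & i = x.2.
  apply/imsetP; suff -> : snd @: C = setT by [].
  by apply/eqP; rewrite eqEcard subsetT cardsT card_ord card_in_imset // cardC leqnn.
have blkE x j : x \in C -> (x.2 \in D j) = (tnth s x.1 == j).
  move=> xC; apply/idP/eqP => [|<-]; last exact: blk.
  by move=> xD; apply: D_inj xD; apply: blk.
have onE x : x \in C -> (x \in B) = on x.1.
  by move=> xC; apply: (@on_B x (tnth s x.1)) => //; apply: blk.
have bef x y : x \in C -> y \in C -> before y.1 x.1 -> y.2 < x.2.
  move=> xC yC /andP[/eqP exy]; set j := tnth s x.1 in exy.
  have xD : x.2 \in D j by apply: blk.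
  have yD : y.2 \in D j by rewrite blkE ?exy.
  have /and3P[/forall_inP c1 /forall_inP c2 /forall_inP c3] := std j.
  case xo: (on x.1); case yo: (on y.1) => //=.
  - move=> lt; have := c3 x; rewrite inE xC xD onE // xo => /(_ isT).
    by move/forall_inP/(_ y); rewrite inE yC yD onE // yo lt; apply.
  - move=> _; rewrite ltnNge; apply/negP=> le.
    have := c1 y; rewrite inE yC yD onE // yo => /(_ isT).
    rewrite -/(D j) card_D.
    set on' := [set x in C | _].
    set off := [set x in C | (x.2 \in D j) && (x \notin B)].
    have cardoff : d j - #|on'| = #|off|.
      have -> : d j = #|[set x in C | x.2 \in D j]|.
        rewrite -card_D -(@card_in_imset _ _ snd); last first.
          by move=> u v; rewrite !inE => /andP[uC _] /andP[vC _]; apply: inj2.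
        apply: eq_card => c; apply/idP/imsetP => [cD|[u]]; last first.
          by rewrite inE => /andP[_ uD] ->.
        by have [u uC cu] := sur2 c; exists u => //; rewrite inE uC -cu.
      rewrite -(cardsID B).
      have -> : [set x in C | x.2 \in D j] :&: B = on'.
        by apply/setP=> u; rewrite !inE -andbA.
      rewrite addKn; apply: eq_card => u; rewrite in_setD.
      rewrite [u \in off]in_set [u \in [set x in C | _]]in_set.
      by case: (u \in B); rewrite /= ?andbF ?andbT.
    rewrite cardoff => _.
    have xoff : x \notin off by rewrite inE onE // xo !andbF.
    have : #|snd @: (x |: off)| <= #|[set c in D j | c < S j + #|off|]|.
      apply: subset_leq_card; apply/subsetP=> c /imsetP[u uin ->{c}].
      have offlt v : v \in off -> v.2 < S j + #|off|.
        move=> vo; have := c1 v vo; rewrite card_D cardoff => lt.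
        have vD : v.2 \in D j by move: vo; rewrite inE => /and3P[].
        have vD' := vD; rewrite in_D in vD'; case/andP: vD' => v1 v2.
        by rewrite -ltn_subLR // -card_Dlt ?v1 ?(ltnW v2).
      case/setU1P: uin => [->|uo].
        rewrite inE xD; apply: leq_ltn_trans le (offlt y _).
        by rewrite inE yC yD onE // yo.
      by rewrite inE offlt // andbT; move: uo; rewrite inE => /and3P[].
    rewrite card_in_imset; last first.
      move=> u v /setU1P uin /setU1P vin; apply: inj2.
        by case: uin => [->|] //; rewrite inE => /and3P[].
      by case: vin => [->|] //; rewrite inE => /and3P[].
    rewrite cardsU1 xoff add1n card_Dlt ?addKn ?ltnn //.
    by rewrite leq_addr leq_add2l -cardoff leq_subr.
  - move=> lt; have := c2 y; rewrite inE yC yD onE // yo => /(_ isT).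
    by move/forall_inP/(_ x); rewrite inE xC xD onE // xo lt; apply.
apply/eqP; rewrite eqEcard card_C0 cardC leqnn andbT.
apply/subsetP=> x xC; rewrite in_C0; apply/eqP/val_inj => /=.
have xD := blk x xC; set j := tnth s x.1 in xD *.
have xD' := xD; rewrite in_D in xD'; case/andP: xD' => x1 x2.
rewrite -(subnKC x1) -(card_Dlt (j := j)) ?x1 ?(ltnW x2) //.
congr (_ + _).
pose E := [set y in C | (y.2 \in D j) && (y.2 < x.2)].
have EC : {subset E <= C} by move=> y; rewrite inE => /andP[].
transitivity #|E|.
  rewrite -(@card_in_imset _ _ snd E); last by move=> ? ? /EC+ /EC; apply: inj2.
  apply: eq_card => c; apply/idP/imsetP => [|[y]]; rewrite !inE.
    case: (sur2 c) => y yC cy cc; exists y => //.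
    by rewrite !inE yC -cy.
  by move=> /andP[_ yy] ->.
rewrite -(@card_in_imset _ _ fst E); last by move=> ? ? /EC+ /EC; apply: inj1.
apply: eq_card => i; apply/imsetP/idP => [[y yE ->]|]; rewrite inE.
  move: yE; rewrite inE => /and3P[yC]; rewrite blkE // => /eqP ys lt.
  case: (boolP (before y.1 x.1)) => // nb.
  have ne : x.1 != y.1.
    by apply/eqP=> /inj1 e; move: lt; rewrite -e // ltnn.
  case/orP: (before_total ys ne) => [bb|]; last by rewrite (negPf nb).
  by have := ltn_trans lt (bef _ _ yC xC bb); rewrite ltnn.
move=> bi; have [y yC iy] := sur1 i; exists y => //; rewrite iy in bi.
by rewrite inE yC blkE // (bef _ _ xC yC bi) andbT; case/andP: bi.
Qed.

Lemma standard_graph_exists_unique : exists! C, is_standard_graph d B s C.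
Proof. by exists C0; split=> [|C /std_C0]. Qed.

Lemma standard_graphP : is_standard_graph d B s (standard_graph d B s).
Proof.
rewrite /standard_graph; case: pickP => //= /(_ C0).
by rewrite C0_std.
Qed.

End StandardGraph.

(* Main.v *)
Require Import Defs.
From HB Require Import structures.
From mathcomp Require Import all_boot all_order all_algebra.
From mathcomp Require Import zify ring.

Set Implicit Arguments.
Unset Strict Implicit.
Unset Printing Implicit Defensive.

Import GRing.Theory.

Local Open Scope nat_scope.

(** Write b for the height of the columns of a block, and call a row on or off
    according to whether its rook is on or off B.  Counting uncrossed squares
    by pairs of rooks, mat becomes an inversion-like statistic: it is the number
    of pairs of rows (x, y), the letter of x smaller than that of y, such that
    x comes after y in the cyclic order of the rows starting at row b(y), except
    that when both rows are on the condition is x < y < b(x) instead of y < x.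
    Pairs in the same block contribute nothing, by standardness.

    Fix the off rows and their letters.  The pairs with exactly one on row then
    contribute a constant, and both rules for the pairs of on rows have the same
    generating function: assign the on rows letter by letter in ascending order;
    the rows of letter l form a subset of the rows still free above height b(l),
    and the generating function of a subset by its inversions with its
    complement does not depend on the order used on the rows.  Hence mat may be
    replaced by the purely cyclic statistic, for which one assigns the rows in
    descending order of the letters and obtains a product of q-binomials. *)

(** * Inversions between a subset and its complement; q-binomials *)

Definition pairs (X : finType) (r : rel X) (S T : {set X}) : nat :=
  \sum_(x in S) \sum_(y in T) r x y.

Lemma pairsU1l (X : finType) (r : rel X) z (S T : {set X}) : z \notin S ->
  pairs r (z |: S) T = \sum_(y in T) r z y + pairs r S T.
Proof. by move=> zS; rewrite /pairs big_setU1. Qed.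

Lemma pairsU1r (X : finType) (r : rel X) z (S T : {set X}) : z \notin T ->
  pairs r S (z |: T) = \sum_(x in S) r x z + pairs r S T.
Proof.
move=> zT; rewrite /pairs -big_split /=; apply: eq_bigr => x _.
by rewrite big_setU1.
Qed.

Section QBinomial.

Variables (K : comNzRingType) (q : K).

(** The Gaussian binomial, by a Pascal rule that asks whether the least element is chosen.
    Truncation of [n' - k'] is harmless, since [qbin n' k' = 0] when [n' < k']. *)
Fixpoint qbin (n k : nat) : K :=
  match n, k with
  | _, 0 => 1
  | 0, _.+1 => 0
  | n'.+1, k'.+1 => q ^+ (n' - k')%N * qbin n' k' + qbin n' k'.+1
  end%R.

Lemma qbin0 n : qbin n 0 = 1%R.
Proof. by case: n. Qed.

Lemma qbin_small n k : n < k -> qbin n k = 0%R.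
Proof.
elim: n k => [|n IH] [|k] //= lt.
by rewrite !IH ?mulr0 ?addr0 // ltnW.
Qed.

(** Induction on [#|A|], removing the element [z] of least rank: if [z] is in [S] it precedes all of
    [A :\: S], which gives the power of [q]; otherwise nothing in [S] precedes it. *)
Lemma sum_pairs_subsets (X : finType) (rk : X -> nat) (A : {set X}) k :
  injective rk ->
  (\sum_(S : {set X} | (S \subset A) && (#|S| == k))
      q ^+ pairs (fun x y => rk x < rk y)%N S (A :\: S) = qbin #|A| k)%R.
Proof.
move=> rkI; move sA: #|A| => m; elim: m A k sA => [|m IH] A [|k] sA.
- have -> : A = set0 by apply/eqP; rewrite -cards_eq0 sA.
  rewrite (big_pred1 set0) ?setD0; last first.
    by move=> S; rewrite /= subset0 cards_eq0 andbb.
  by rewrite /pairs big_set0 expr0.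
- rewrite big1 //= => S /andP[/subset_leq_card]; rewrite sA leqn0.
  by move=> /eqP->.
- rewrite (big_pred1 set0) ?qbin0; last first.
    move=> S /=; rewrite cards_eq0 andbC; case: eqP => // ->.
    by rewrite sub0set.
  by rewrite /pairs big_set0 expr0.
have [x0 x0A] : exists x, x \in A by apply/card_gt0P; rewrite sA.
have [z zA zmin] : exists2 z, z \in A & forall y, y \in A -> rk z <= rk y.
  by case: (arg_minnP rk x0A) => z; exists z.
pose A' := A :\ z.
have AE : A = z |: A' by rewrite setD1K.
have zA' : z \notin A' by rewrite !inE eqxx.
have sA' : #|A'| = m by move: sA; rewrite AE cardsU1 zA' add1n => -[].
have zlt y : y \in A' -> rk z < rk y.
  rewrite !inE => /andP[yz /zmin]; rewrite leq_eqVlt => /orP[|//].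
  by rewrite inj_eq // eq_sym (negPf yz).
rewrite (bigID (fun S : {set X} => z \in S)) /=; congr (_ + _)%R.
- rewrite -(IH A') // big_distrr /=.
  rewrite (reindex_onto (fun S => z |: S) (fun S => S :\ z)) /=; last first.
    by move=> S /andP[_ zS]; rewrite setD1K.
  apply: eq_big => [S|S /andP[/andP[/andP[SA cS] zS] /eqP SE]].
    rewrite setU11 andbT; apply/idP/idP.
      case/andP=> /andP[SA cS] /eqP SE.
      have zS : z \notin S by rewrite -SE !inE eqxx.
      move: cS; rewrite cardsU1 zS add1n eqSS => ->; rewrite andbT.
      rewrite -SE; apply: setSD; apply: subset_trans SA _.
      exact: subxx.
    case/andP=> SA' cS.
    have zS : z \notin S by apply: contra zA'; apply: (subsetP SA').
    by rewrite cardsU1 zS add1n eqSS cS setU1K // eqxx [A]AE setUS.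
  have zS' : z \notin S by rewrite -SE !inE eqxx.
  have D : A :\: (z |: S) = A' :\: S.
    by rewrite setDDl.
  rewrite D pairsU1l // exprD; congr (_ ^+ _ * _)%R.
  rewrite (eq_bigr (fun=> 1)).
    rewrite sum1_card cardsD (setIidPr _); last first.
      by rewrite -SE; apply: setSD.
    by rewrite sA'; move: cS; rewrite cardsU1 zS' add1n eqSS => /eqP->.
  by move=> y /setDP[yA' _]; rewrite zlt.
- rewrite -(IH A') //; apply: eq_big => [S|S /andP[/andP[SA cS] zS]].
    by rewrite /A' subsetD1 -!andbA [_ && (z \notin S)]andbC.
  have -> : A :\: S = z |: (A' :\: S).
    apply/setP=> x; rewrite !inE; case: eqP => [->|] /=; first by rewrite zS zA.
    by [].
  rewrite pairsU1r ?inE ?eqxx ?andbF // big1 ?add0n // => x xS.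
  apply/eqP; rewrite eqb0 -leqNgt ltnW // zlt // !inE (subsetP SA) // andbT.
  by apply: contraNneq zS => <-.
Qed.

End QBinomial.

(** * Words assigned letter by letter *)

Section Words.

Variables (X L : finType) (K : comNzRingType) (q : K).
Variables (e : rel L) (P : L -> {set X}) (k : L -> nat).
Hypothesis e_asym : forall a b, e a b -> ~~ e b a.

(** Outside [A] the word is pinned to [g], so that each filling of [A] is a single total
    function. *)
Definition admissible (g : X -> L) (A : {set X}) (ls : seq L)
    (f : {ffun X -> L}) : bool :=
  [forall x, if x \in A then (f x \in ls) && (x \in P (f x)) else f x == g x]
  && all (fun l => #|[set x in A | f x == l]| == k l) ls.

(** The rule [v] sees only the letter of [x], so that one fixed relation governs all pairs starting
    at a given letter. *)
Definition weight (v : L -> rel X) (A : {set X}) (f : X -> L) : nat :=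
  \sum_(x in A) \sum_(y in A) (e (f x) (f y) && v (f x) x y).

Definition fill (g : X -> L) (S : {set X}) (l : L) (x : X) : L :=
  if x \in S then l else g x.

Let e_irr a : e a a = false.
Proof. by apply/negP=> aa; have := e_asym aa; rewrite aa. Qed.

(** As [l] comes first for [e], pairs between [S] and the rest count only in the direction from [S],
    and pairs inside [S] not at all. *)
Lemma weight_peel v (A S : {set X}) l (f : X -> L) :
  S = [set x in A | f x == l] -> (forall x, x \in A :\: S -> e l (f x)) ->
  weight v A f = pairs (v l) S (A :\: S) + weight v (A :\: S) f.
Proof.
move=> SE lt.
have SA : S \subset A by rewrite SE; apply/subsetP=> x; rewrite inE => /andP[].
have fS x : x \in S -> f x = l by rewrite SE inE => /andP[_ /eqP].
have split (F : X -> nat) :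
    \sum_(x in A) F x = \sum_(x in S) F x + \sum_(x in A :\: S) F x.
  rewrite (big_setID S) /=; congr (_ + _); apply: eq_bigl => x.
  by rewrite (setIidPr SA).
rewrite /weight split; congr (_ + _); apply: eq_bigr => x xS; rewrite split.
  rewrite big1 ?add0n => [|y yS]; last by rewrite !fS // e_irr.
  by apply: eq_bigr => y yA; rewrite (fS x) // lt.
rewrite big1 ?add0n // => y yS.
by rewrite (fS y) // (negPf (e_asym _)) // lt.
Qed.

Lemma admissible_peel g (A S : {set X}) l ls f :
    l \notin ls -> S \subset A :&: P l -> #|S| = k l ->
  admissible g A (l :: ls) f && ([set x in A | f x == l] == S) =
  admissible (fill g S l) (A :\: S) ls f.
Proof.
move=> lls SAP cS; apply/idP/idP.
  case/andP=> /andP[/forallP fA /= /andP[_ cnt]] /eqP SE; apply/andP; split.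
    apply/forallP=> x; have := fA x; rewrite /fill -SE !inE.
    by case: (x \in A) => //=; case: (f x =P l) => //= /eqP.
  apply/allP=> m mls; rewrite -(eqP (allP cnt m mls)); apply/eqP.
  apply: eq_card => x; rewrite !inE -SE inE; case: (x \in A) => //=.
  rewrite andbT; case: (f x =P m) => [->|]; rewrite ?andbF //.
  by rewrite andbT; apply: contraNneq lls => <-.
case/andP=> /forallP fA cnt.
have SE : [set x in A | f x == l] = S.
  apply/setP=> x; rewrite inE; have := fA x; rewrite /fill !inE.
  case xS: (x \in S) => /=.
    by move=> ->; have := subsetP SAP x xS; rewrite inE => /andP[->].
  case: (x \in A) => //= /andP[fls _].
  by apply/negP => /eqP fl; move: lls; rewrite -fl fls.
rewrite SE eqxx andbT; apply/andP; split.
  apply/forallP=> x; have := fA x; rewrite /fill !inE.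
  case xS: (x \in S) => /=.
    have := subsetP SAP x xS; rewrite inE => /andP[-> xP] /eqP->.
    by rewrite eqxx.
  by case: (x \in A) => //= /andP[-> ->]; rewrite orbT.
rewrite /= SE cS eqxx /=.
apply/allP=> m mls; rewrite -(eqP (allP cnt m mls)); apply/eqP.
apply: eq_card => x; rewrite !inE -SE inE; case: (x \in A) => //=.
rewrite andbT; case: (f x =P m) => [->|]; rewrite ?andbF //.
by rewrite andbT; apply/esym; apply: contraNneq lls => <-.
Qed.

Lemma sum_peel v g A l ls : pairwise e (l :: ls) ->
  (\sum_(f | admissible g A (l :: ls) f) q ^+ weight v A f =
   \sum_(S : {set X} | (S \subset A :&: P l) && (#|S| == k l))
     q ^+ pairs (v l) S (A :\: S) *
     \sum_(f | admissible (fill g S l) (A :\: S) ls f) q ^+ weight v (A :\: S) f)%R.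
Proof.
case/andP=> /allP ell _.
have lls : l \notin ls by apply/negP=> /ell; rewrite e_irr.
rewrite (partition_big (fun f : {ffun X -> L} => [set x in A | f x == l])
  (fun S : {set X} => (S \subset A :&: P l) && (#|S| == k l))) /=; last first.
  move=> f /andP[/forallP fA /andP[-> _]]; rewrite andbT.
  apply/subsetP=> x; rewrite !inE => /andP[xA /eqP fx].
  by have := fA x; rewrite xA fx => /andP[_ ->].
apply: eq_bigr => S /andP[SAP /eqP cS]; rewrite big_distrr /=.
apply: eq_big => [f|f]; first exact: admissible_peel.
move=> /andP[/andP[/forallP fA _] /eqP SE].
rewrite -exprD (weight_peel _ (esym SE)) // => x /setDP[xA xS].
have := fA x; rewrite xA inE => /andP[/orP[/eqP fx|/ell //] _].
by move: xS; rewrite -SE inE xA fx eqxx.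
Qed.

(* [a l] is the number of positions open to the letter [l], and [s] the number
   of positions not yet filled. *)
Fixpoint word_gf (ls : seq L) (a : L -> nat) (s : nat) : K :=
  match ls with
  | [::] => (s == 0)%:R
  | l :: ls' => qbin q (a l) (k l) * word_gf ls' (fun m => a m - k l)%N (s - k l)%N
  end%R.

Lemma eq_word_gf ls a b s : {in ls, a =1 b} -> word_gf ls a s = word_gf ls b s.
Proof.
elim: ls a b s => //= l ls IH a b s ab.
rewrite ab ?mem_head //; congr (_ * _)%R; apply: IH => m mls.
by rewrite ab // inE mls orbT.
Qed.

(** Choosing the positions of the first letter gives a q-binomial whatever the order [rk l]. By
    monotonicity of [P] these positions were open to every later letter, so the later counts drop by
    [k l] for every choice. *)
Lemma sum_words (rk : L -> X -> nat) g A ls :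
    (forall l, injective (rk l)) ->
    (forall a b, e a b -> P a \subset P b) -> pairwise e ls ->
  (\sum_(f | admissible g A ls f)
     q ^+ weight (fun l x y => (rk l x < rk l y)%N && (y \in P l)) A f =
   word_gf ls (fun m => #|A :&: P m|) #|A|)%R.
Proof.
move=> rkI Pmono; elim: ls g A => [|l ls IH] g A.
  move=> _ /=; rewrite cards_eq0; case: eqP => [->|/eqP/set0Pn[x xA]].
    rewrite (big_pred1 [ffun x => g x]) => [|f].
      by rewrite /weight big_set0 expr0.
    rewrite /admissible andbT; apply/forallP/eqP => [fg|-> x].
      by apply/ffunP=> x; have := fg x; rewrite inE ffunE => /eqP.
    by rewrite inE ffunE.
  rewrite big_pred0 // => f; apply/negP=> /andP[/forallP/(_ x)].
  by rewrite xA.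
move=> lls; rewrite sum_peel //=; case/andP: lls => /allP ell pls.
rewrite -(sum_pairs_subsets q (A :&: P l) _ (rkI l)) big_distrl /=.
apply: eq_bigr => S /andP[SAP /eqP cS]; rewrite IH //; congr (_ ^+ _ * _)%R.
  rewrite /pairs; apply: eq_bigr => x _.
  rewrite [RHS]big_mkcond [LHS]big_mkcond; apply: eq_bigr => y _; rewrite !inE.
  by case: (y \in S); case: (y \in A); case: (y \in P l); rewrite /= ?andbT ?andbF.
have SA : S \subset A by apply: subset_trans SAP (subsetIl _ _).
have SP : S \subset P l by apply: subset_trans SAP (subsetIr _ _).
rewrite cardsD (setIidPr SA) cS; apply: eq_word_gf => m mls.
have /setIidPr SE : S \subset A :&: P m.
  by rewrite subsetI SA (subset_trans SP (Pmono _ _ (ell _ mls))).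
by rewrite setIDAC cardsD SE cS.
Qed.

End Words.

(** * Trading the [mat] rule for the cyclic rule *)

Section OnOff.

Variables (n t : nat) (K : comNzRingType) (q : K) (b d : 'I_t -> nat).
Hypothesis b_mono : forall l m : 'I_t, l <= m -> b l <= b m.

Implicit Types (f g : 'I_n -> 'I_t).

Definition counted f : bool := [forall l, #|[set x | f x == l]| == d l].

Definition on_rows f : {set 'I_n} := [set x : 'I_n | x < b (f x)].

(* Reading the rows downwards and cyclically from row [b c], the row [x] comes
   after the row [y]. *)
Definition cyc_after (c : 'I_t) (x y : 'I_n) : bool :=
  if y < b c then y < x < b c else (y < x) || (x < b c).

(* [a] and [c] are the letters of the rows [x] and [y], with [a < c]. *)
Definition mat_pair (a c : 'I_t) (x y : 'I_n) : bool :=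
  if (x < b a) && (y < b c) then x < y < b a else cyc_after c x y.

Definition mat_weight f : nat :=
  \sum_x \sum_y ((f x < f y) && mat_pair (f x) (f y) x y).

Definition cyc_weight f : nat :=
  \sum_x \sum_y ((f x < f y) && cyc_after (f y) x y).

(** The pairs with at least one off row, on which both rules are the same. *)
Definition mixed_weight f : nat :=
  let A := on_rows f in
  \sum_(x in A) \sum_(y in ~: A) ((f x < f y) && cyc_after (f y) x y) +
  (\sum_(x in ~: A) \sum_(y in A) ((f x < f y) && cyc_after (f y) x y) +
   \sum_(x in ~: A) \sum_(y in ~: A) ((f x < f y) && cyc_after (f y) x y)).

Let big_split_set (A : {set 'I_n}) (T : 'I_n -> 'I_n -> nat) :
  \sum_x \sum_y T x y = \sum_(x in A) \sum_(y in A) T x y +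
  (\sum_(x in A) \sum_(y in ~: A) T x y +
   (\sum_(x in ~: A) \sum_(y in A) T x y +
    \sum_(x in ~: A) \sum_(y in ~: A) T x y)).
Proof.
have E (F : 'I_n -> nat) : \sum_x F x = \sum_(x in A) F x + \sum_(x in ~: A) F x.
  rewrite (bigID (mem A)) /=; congr (_ + _); apply: eq_bigl => x.
  by rewrite inE.
rewrite E addnA -!big_split /=; congr (_ + _); apply: eq_bigr => x _; exact: E.
Qed.

Let e_asc : rel 'I_t := fun l m => l < m.
Let P_on (l : 'I_t) : {set 'I_n} := [set x : 'I_n | x < b l].

Let asc_asym l m : e_asc l m -> ~~ e_asc m l.
Proof. by rewrite /e_asc -leqNgt => /ltnW. Qed.

Lemma mat_weight_split f :
  mat_weight f =
  weight e_asc (fun l (x y : 'I_n) => (x < y) && (y \in P_on l)) (on_rows f) f +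
  mixed_weight f.
Proof.
rewrite /mat_weight (big_split_set (on_rows f)); congr (_ + (_ + (_ + _))).
- apply: eq_bigr => x; rewrite inE => xA; apply: eq_bigr => y.
  by rewrite inE /mat_pair xA inE => ->.
- apply: eq_bigr => x _; apply: eq_bigr => y; rewrite !inE /mat_pair => /negPf->.
  by rewrite andbF.
- apply: eq_bigr => x; rewrite !inE /mat_pair => /negPf-> /=.
  by apply: eq_bigr => y _.
- apply: eq_bigr => x; rewrite !inE /mat_pair => /negPf-> /=.
  by apply: eq_bigr => y _.
Qed.

(** For on rows with [f x < f y], one has [x < b (f x) <= b (f y)], so the cyclic rule reads
    [y < x], and [y < b (f x)] follows. The rank [n - x] reverses the order. *)
Lemma cyc_weight_split f :
  cyc_weight f =
  weight e_asc (fun l (x y : 'I_n) => (n - x < n - y) && (y \in P_on l)) (on_rows f) f +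
  mixed_weight f.
Proof.
rewrite /cyc_weight (big_split_set (on_rows f)); congr (_ + _).
apply: eq_bigr => x; rewrite inE => xA; apply: eq_bigr => y.
rewrite inE /cyc_after /e_asc inE => yA; rewrite yA; congr nat_of_bool.
case: ltnP => //= /ltnW/b_mono le.
by move: (ltn_ord x) (ltn_ord y) => xn yn; apply/idP/idP; lia.
Qed.

Lemma on_off_pair f x y : x \in on_rows f -> y \notin on_rows f ->
  (f x < f y) && cyc_after (f y) x y = (f x < f y).
Proof.
rewrite !inE /cyc_after => xA /negPf->; case: ltnP => //= /ltnW/b_mono le.
by rewrite (leq_trans xA le) orbT.
Qed.

(** If [f y <= f x], then [y < b (f y) <= x] and all terms vanish; otherwise [x <= y] already forces
    [x < b (f y)]. *)
Lemma off_on_pair f x y : x \notin on_rows f -> y \in on_rows f ->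
  ((f x < f y) && cyc_after (f y) x y) + (x <= y) = (x < b (f y)).
Proof.
rewrite !inE /cyc_after -leqNgt => xA yA; rewrite yA.
have := @b_mono (f y) (f x); lia.
Qed.

Let sum_letters (A : {set 'I_n}) f (F : 'I_t -> nat) :
  \sum_(x in A) F (f x) = \sum_l #|[set x in A | f x == l]| * F l.
Proof.
rewrite (partition_big f xpredT) //=; apply: eq_bigr => l _.
rewrite -sum_nat_const; apply: eq_big => [x|x /andP[_ /eqP->] //].
by rewrite inE.
Qed.

(* Only the letters' multiplicities matter: an on row x and an off row y give
   [f x < f y], an off row x and an on row y give [x < b (f y)] - [x <= y]. *)
Lemma eq_mixed_weight f g :
    on_rows f = on_rows g -> {in ~: on_rows g, f =1 g} ->
    (forall l, #|[set x in on_rows g | f x == l]| =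
               #|[set x in on_rows g | g x == l]|) ->
  mixed_weight f = mixed_weight g.
Proof.
move=> Afg fg cnt; rewrite /mixed_weight Afg; set A := on_rows g.
have sums F : \sum_(x in A) F (f x) = \sum_(x in A) F (g x).
  by rewrite !sum_letters; apply: eq_bigr => l _; rewrite cnt.
congr (_ + (_ + _)).
- rewrite exchange_big [RHS]exchange_big /=; apply: eq_bigr => y yA.
  have yA' : y \notin A by rewrite -in_setC.
  rewrite (eq_bigr (fun x => (f x < g y) : nat)); last first.
    by move=> x xA; rewrite on_off_pair ?Afg // (fg y).
  rewrite [RHS](eq_bigr (fun x => (g x < g y) : nat)); last first.
    by move=> x xA; rewrite on_off_pair.
  exact: (sums (fun l : 'I_t => (l < g y) : nat)).
- apply: eq_bigr => x; rewrite in_setC => xA.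
  apply/(@addIn (\sum_(y in A) (x <= y))); rewrite -!big_split /=.
  rewrite (eq_bigr (fun y => (x < b (f y)) : nat)); last first.
    by move=> y yA; rewrite off_on_pair ?Afg.
  rewrite [RHS](eq_bigr (fun y => (x < b (g y)) : nat)); last first.
    by move=> y yA; rewrite off_on_pair.
  exact: (sums (fun l => (x < b l) : nat)).
- by apply: eq_bigr => x xA; apply: eq_bigr => y yA; rewrite !fg.
Qed.

Let pairwise_enum : pairwise e_asc (enum 'I_t).
Proof.
have := iota_ltn_sorted 0 t; rewrite -val_enum_ord sorted_pairwise.
  by rewrite pairwise_map.
exact: ltn_trans.
Qed.

(** The data held fixed when the sum is partitioned: the off rows with their letters. *)
Let mask f : {ffun 'I_n -> option 'I_t} :=
  [ffun x : 'I_n => if x < b (f x) then None else Some (f x)].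

Let on_mask f : on_rows f = [set x | mask f x == None].
Proof. by apply/setP=> x; rewrite !inE ffunE; case: ifP. Qed.

Let mask_eqE f g : mask f = mask g ->
  on_rows f = on_rows g /\ {in ~: on_rows g, f =1 g}.
Proof.
move=> E; split; first by rewrite !on_mask E.
move=> x; rewrite !inE => /negPf gx; have /ffunP/(_ x) := E.
by rewrite /mask !ffunE gx; case: ifP => // _ [].
Qed.

Let card_letter_split (A : {set 'I_n}) f l : #|[set x | f x == l]| =
  #|[set x in A | f x == l]| + #|[set x in ~: A | f x == l]|.
Proof.
by rewrite -[LHS](cardsID A); congr (_ + _); apply: eq_card => x; rewrite !inE // andbC.
Qed.

(** Once the off rows are fixed, the multiplicities are right exactly when those on the on rows
    match [g]. A fibre of [mask] thus has the form that [sum_words] evaluates. *)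
Let mask_class (f g : {ffun 'I_n -> 'I_t}) : counted g ->
  counted f && (mask f == mask g) =
  admissible P_on (fun l => #|[set x in on_rows g | g x == l]|)
    g (on_rows g) (enum 'I_t) f.
Proof.
move=> /forallP cg; apply/idP/idP.
  case/andP=> /forallP cf /eqP /mask_eqE[Afg fg]; apply/andP; split.
    apply/forallP=> x; case: ifP => xA; last by rewrite fg // inE xA.
    by move: xA; rewrite -Afg mem_enum !inE => ->.
  apply/allP=> l _; have := cf l; rewrite -(eqP (cg l)).
  rewrite !(card_letter_split (on_rows g)).
  have -> : [set x in ~: on_rows g | f x == l] = [set x in ~: on_rows g | g x == l].
    apply/setP=> x; rewrite !inE; case gx: (x < _) => //=; rewrite fg //.
    by rewrite !inE gx.
  by rewrite eqn_add2r.
case/andP=> /forallP fA cnt.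
have fg : {in ~: on_rows g, f =1 g}.
  by move=> x; rewrite inE => /negPf xA; have := fA x; rewrite xA => /eqP.
have fon x : x \in on_rows g -> x < b (f x).
  by move=> xA; have := fA x; rewrite xA => /andP[_]; rewrite inE.
apply/andP; split.
  apply/forallP=> l; rewrite -(eqP (cg l)) !(card_letter_split (on_rows g)).
  rewrite (eqP (allP cnt l (mem_enum _ _))) eqn_add2l; apply/eqP.
  apply: eq_card => x; rewrite !inE; case gx: (x < _) => //=; rewrite fg //.
  by rewrite !inE gx.
apply/eqP/ffunP=> x; rewrite !ffunE; case gx: (x < b (g x)).
  by rewrite fon // inE.
by rewrite fg ?gx // !inE gx.
Qed.

Lemma sum_mat_cyc :
  (\sum_(f : {ffun 'I_n -> 'I_t} | counted f) q ^+ mat_weight f =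
   \sum_(f : {ffun 'I_n -> 'I_t} | counted f) q ^+ cyc_weight f)%R.
Proof.
rewrite (partition_big (fun f : {ffun 'I_n -> 'I_t} => mask f) xpredT) //.
rewrite [RHS](partition_big (fun f : {ffun 'I_n -> 'I_t} => mask f) xpredT) //.
apply: eq_bigr => m _.
case: (pickP (fun f : {ffun 'I_n -> 'I_t} => counted f && (mask f == m)));
  last by move=> no; rewrite !big_pred0.
move=> g /andP[cg /eqP <-].
have mixE (f : {ffun 'I_n -> 'I_t}) :
    counted f && (mask f == mask g) ->
    on_rows f = on_rows g /\ mixed_weight f = mixed_weight g.
  move=> fP; have [Afg fg] := mask_eqE (eqP (andP fP).2).
  split=> //; apply: eq_mixed_weight => // l; move: fP.
  by rewrite mask_class // => /andP[_ /allP/(_ l)]; rewrite mem_enum => /(_ isT)/eqP.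
rewrite (eq_bigr (fun f : {ffun 'I_n -> 'I_t} => q ^+ mixed_weight g *
    q ^+ weight e_asc (fun l (x y : 'I_n) => (x < y)%N && (y \in P_on l)) (on_rows g) f))%R;
  last first.
  by move=> f /mixE[Afg mfg]; rewrite mat_weight_split Afg mfg addnC exprD.
rewrite [RHS](eq_bigr (fun f : {ffun 'I_n -> 'I_t} => q ^+ mixed_weight g *
    q ^+ weight e_asc (fun l (x y : 'I_n) => (n - x < n - y)%N && (y \in P_on l)) (on_rows g) f))%R;
  last first.
  by move=> f /mixE[Afg mfg]; rewrite cyc_weight_split Afg mfg addnC exprD.
rewrite -!big_distrr /=; congr (_ * _)%R.
have P_mono (l l' : 'I_t) : e_asc l l' -> P_on l \subset P_on l'.
  move=> /ltnW/b_mono le; apply/subsetP=> x; rewrite !inE => lt.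
  exact: leq_trans lt le.
rewrite !(eq_bigl _ _ (fun f : {ffun 'I_n -> 'I_t} => mask_class f cg)).
(* [word_gf] does not involve the ranks, so the orders by [x] and by [n - x] give the same value. *)
rewrite (sum_words _ _ asc_asym (rk := fun _ (x : 'I_n) => x : nat)) //; last first.
  by move=> _; apply: val_inj.
rewrite (sum_words _ _ asc_asym (rk := fun _ (x : 'I_n) => n - x)) // => _ x y E.
by apply: val_inj; move: (ltn_ord x) (ltn_ord y) E => /= xn yn; lia.
Qed.

Let e_desc : rel 'I_t := fun l m => m < l.

(** Orders the rows as read cyclically from row [b c]: those above it wrap around, hence the shift
    by [n]. *)
Definition cyc_rank (c : 'I_t) (z : 'I_n) : nat := if z < b c then n + z else z.

Lemma cyc_rank_inj c : injective (cyc_rank c).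
Proof.
move=> x y E; apply: val_inj; move: (ltn_ord x) (ltn_ord y) E.
by rewrite /cyc_rank; do 2 case: ifP; rewrite /=; lia.
Qed.

Lemma cyc_after_rank c x y : x != y -> cyc_after c x y = (cyc_rank c y < cyc_rank c x).
Proof.
move=> xy; have {xy} : x != y :> nat by [].
move: (ltn_ord x) (ltn_ord y); rewrite /cyc_after /cyc_rank.
case yb: (y < b c); case xb: (x < b c);
  by rewrite ?andbT ?andbF ?orbF ?orbT => *; apply/idP/idP; lia.
Qed.

(** The rule [cyc_after (f y)] follows the larger letter, so the letters are peeled in descending
    order; [P] is full, so every free position is open. *)
Lemma sum_cyc (g : 'I_n -> 'I_t) :
  (\sum_(f : {ffun 'I_n -> 'I_t} | counted f) q ^+ cyc_weight f =
   word_gf q d (rev (enum 'I_t)) (fun=> n) n)%R.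
Proof.
have desc_asym l m : e_desc l m -> ~~ e_desc m l.
  by rewrite /e_desc -leqNgt => /ltnW.
have := sum_words q d desc_asym (P := fun=> setT) g setT (ls := rev (enum 'I_t))
  cyc_rank_inj.
have e_trans : transitive e_desc by move=> y x z yx zy; apply: ltn_trans zy yx.
have e_trans' : transitive e_asc by move=> y x z; apply: ltn_trans.
rewrite -sorted_pairwise // rev_sorted sorted_pairwise //.
move=> /(_ (fun _ _ _ => subxx _) pairwise_enum).
rewrite cardsT card_ord => E.
transitivity (word_gf q d (rev (enum 'I_t)) (fun m => #|[set: 'I_n] :&: setT|) n);
  last by apply: eq_word_gf => m _; rewrite setIT cardsT card_ord.
rewrite -E; apply: eq_big => [f|f _].
  rewrite /counted /admissible; apply/forallP/andP => [cf|[_ /allP cf] l].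
    split; first by apply/forallP=> x; rewrite !inE mem_rev mem_enum inE.
    apply/allP=> l _; rewrite -(eqP (cf l)); apply/eqP; apply: eq_card => x.
    by rewrite !inE.
  have := cf l; rewrite mem_rev mem_enum => /(_ isT)/eqP<-.
  by apply/eqP; apply: eq_card => x; rewrite !inE.
(* [weight] takes its rule from its first row, here the one with the larger letter: hence the
   swap. *)
congr (_ ^+ _)%R; rewrite /cyc_weight /weight exchange_big /=.
rewrite [RHS]big_mkcond; apply: eq_bigr => y _; rewrite inE.
rewrite [RHS]big_mkcond; apply: eq_bigr => x _; rewrite !inE andbT /e_desc.
case: ltnP => //= lt; rewrite cyc_after_rank //.
by apply: contraTneq lt => ->; rewrite ltnn.
Qed.

End OnOff.

(** * q-factorials and q-multinomials *)

Lemma qint_add m k : (qint (m + k) = qvar ^+ m * qint k + qint m)%R.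
Proof. by rewrite /qint exprD; ring. Qed.

Lemma qfactS m : (qfact m.+1 = qfact m * qint m.+1)%R.
Proof. by rewrite /qfact big_nat_recr. Qed.

Lemma qfact0 : qfact 0 = 1%R.
Proof. by rewrite /qfact big_geq. Qed.

Lemma qint_neq0 m : (qint m.+1 != 0)%R.
Proof.
have qv_neq0 k : (1 - qvar ^+ k.+1 != 0)%R.
  rewrite subr_eq0 /qvar -rmorphXn -(rmorph1 (@tofrac _)) tofrac_eq.
  apply/eqP=> /(congr1 (fun p : {poly rat} => size p)).
  by rewrite size_poly1 size_polyXn.
rewrite /qint mulf_neq0 // invr_eq0; have := qv_neq0 0; by rewrite expr1.
Qed.

Lemma qfact_neq0 m : (qfact m != 0)%R.
Proof.
elim: m => [|m IH]; first by rewrite qfact0; exact: oner_neq0.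
by rewrite qfactS; apply: mulf_neq0 IH (qint_neq0 m).
Qed.

(** Induction by the Pascal rule, with $[n+1] = q^{n-k}[k+1] + [n-k]$. *)
Lemma qbin_fact n k : k <= n ->
  (qbin qvar n k * (qfact k * qfact (n - k)) = qfact n)%R.
Proof.
elim: n k => [|n IH] [|k] // le.
- by rewrite /= qfact0 !mul1r.
- by rewrite qbin0 qfact0 subn0 !mul1r.
have E1 := IH k le; rewrite subSS /= mulrDl.
have -> : (qvar ^+ (n - k) * qbin qvar n k * (qfact k.+1 * qfact (n - k)) =
   qfact n * (qvar ^+ (n - k) * qint k.+1))%R.
  by rewrite -E1 qfactS; ring.
have -> : (qbin qvar n k.+1 * (qfact k.+1 * qfact (n - k)) =
   qfact n * qint (n - k))%R.
  move: le; rewrite ltnS leq_eqVlt => /orP[/eqP<-|lt].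
    by rewrite subnn qbin_small // /qint expr0 subrr !mul0r mulr0.
  have E : n - k = (n - k.+1).+1 by rewrite -subSn.
  by rewrite -(IH k.+1) // E (qfactS (n - k.+1)); ring.
by rewrite -mulrDr -qint_add qfactS addnS subnK.
Qed.

(** Every remaining position is open, so each factor is $[s]!/([d_l]!\,[s-d_l]!)$ and the product
    telescopes. *)
Lemma word_gf_fact t (d : 'I_t -> nat) ls s : s = \sum_(l <- ls) d l ->
  (word_gf qvar d ls (fun=> s) s * \prod_(l <- ls) qfact (d l) = qfact s)%R.
Proof.
elim: ls s => [|l ls IH] s; rewrite ?big_nil ?big_cons => sE.
  by rewrite sE /= qfact0 mulr1.
have le : d l <= s by rewrite sE leq_addr.
rewrite /= -[RHS](qbin_fact le) -(IH (s - d l)); last by rewrite sE addKn.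
ring.
Qed.


(** * [mat] as a sum over pairs of rooks *)

Section RookPairs.

Variables (n : nat) (C B : {set square n}) (col : 'I_n -> 'I_n).
Variable bd : 'I_n -> nat.
Hypothesis col_inj : injective col.
Hypothesis in_C : forall x, (x \in C) = (x.2 == col x.1).
Hypothesis in_B : forall i j, ((i, col j) \in B) = (i < bd j).

(** Squares are indexed by pairs of rooks. The only rook of row [i] decides the first clause, and
    the only rook of column [col j], a column of height [bd j], the other two. *)
Lemma in_crossed i j : ((i, col j) \in crossed C B) =
  [|| col i <= col j, (i < bd j) && (i < j) | (bd j <= j) && (j < i)].
Proof.
rewrite inE in_B; congr [|| _, _ && _ | _].
- apply/exists_inP/idP => [[y]|le]; first by rewrite in_C => /eqP-> /andP[/eqP->].
  by exists (i, col i); rewrite ?in_C /= ?eqxx.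
- apply/exists_inP/idP => [[y]|lt].
    by rewrite in_C => /eqP-> /andP[/eqP/col_inj->].
  by exists (j, col j); rewrite ?in_C /= ?eqxx.
- apply/exists_inP/andP => [[[r c]]|[le lt]].
    rewrite in_C /= => /eqP-> /and3P[+ /eqP/col_inj rj]; rewrite rj in_B -leqNgt.
    by [].
  by exists (j, col j); rewrite ?in_C /= ?eqxx ?in_B -?leqNgt ?le.
Qed.

Let col_bij : bijective col.
Proof. exact: injF_bij. Qed.

Let card_square (E : {set square n}) :
  #|E| = \sum_i \sum_j ((i, col j) \in E).
Proof.
rewrite -sum1_card big_mkcond /= (pair_big_dep xpredT (fun _ => xpredT)) /=.
rewrite (reindex (fun p : square n => (p.1, col p.2))) /=.
  by apply: eq_bigr => p _; case: (_ \in _).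
have [g gK Kg] := col_bij.
by exists (fun p => (p.1, g p.2)) => [[i j] _|[i j] _] /=; rewrite ?gK ?Kg.
Qed.

Let card_on : #|C :&: B| = \sum_(j < n) (j < bd j).
Proof.
rewrite card_square; apply: eq_bigr => i _; rewrite (bigD1 i) //= big1 ?addn0.
  by rewrite in_setI in_C in_B /= eqxx.
move=> j ji; rewrite in_setI in_C /= (inj_eq col_inj).
by rewrite (negPf ji).
Qed.

(* [(i, col j)] and [(j, col i)] are treated together, which is why the
   hypothesis on [V] is symmetrized. *)
Lemma mat_pairsE (V : 'I_n -> 'I_n -> nat) :
    (forall i, V i i = 0) ->
    (forall i j, col j < col i ->
       (i < bd j) + (j < bd i) + 1 =
       ((i < bd j) && (i < j) || (bd j <= j) && (j < i)) +
       (j < bd j) + (i < bd i) + V i j + V j i) ->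
  mat C B = (\sum_i \sum_j V i j)%N%:Z%R.
Proof.
move=> V0 Vpair.
have eq_sym_sum (F G : 'I_n -> 'I_n -> nat) :
    (forall i j, F i j + F j i = G i j + G j i) ->
    \sum_i \sum_j F i j = \sum_i \sum_j G i j.
  move=> FG; apply: double_inj; rewrite -!addnn.
  rewrite {2}exchange_big [X in _ = _ + X]exchange_big /= -!big_split /=.
  by apply: eq_bigr => i _; rewrite -!big_split; apply: eq_bigr => j _; exact: FG.
(* Summed, [1] gives $n^2$, [j < bd j] gives $nk$ and [i < bd j] the area. When [col j < col i], the
   square [(j, col i)] is crossed, being to the right of rook [j]; this cancels one of the two ones
   of the symmetrized identity. *)
have E : \sum_(i < n) \sum_(j < n) (1 + (i < bd j)) =
    \sum_(i < n) \sum_(j < n) (((i, col j) \in crossed C B) + (j < bd j) + V i j).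
  apply: eq_sym_sum => i j; rewrite !in_crossed.
  case: (ltngtP (col j) (col i)) => [lt|gt|/val_inj/col_inj->].
  - by have := Vpair _ _ lt; lia.
  - by have := Vpair _ _ gt; lia.
  - by rewrite V0 /=; lia.
have nn : n * n = \sum_(i < n) \sum_(j < n) 1.
  by rewrite sum_nat_const card_ord sum1_card card_ord.
have nk : n * #|C :&: B| = \sum_(i < n) \sum_(j < n) (j < bd j).
  by rewrite sum_nat_const card_ord card_on.
have cB : #|B| = \sum_(i < n) \sum_(j < n) (i < bd j).
  rewrite card_square; apply: eq_bigr => i _; apply: eq_bigr => j _.
  by rewrite in_B.
have cc : cross C B = \sum_(i < n) \sum_(j < n) ((i, col j) \in crossed C B).
  exact: card_square.
have {}E : n * n + #|B| =
    cross C B + n * #|C :&: B| + \sum_(i < n) \sum_(j < n) V i j.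
  rewrite nn nk cB cc -!big_split /=.
  under eq_bigr do rewrite -big_split /=.
  under [RHS]eq_bigr do rewrite -!big_split /=.
  exact: E.
rewrite /mat mulrBr -!PoszM; move: E.
by move: (n * n) (n * _) (\sum_i _) => *; lia.
Qed.

End RookPairs.

(** * The standard graph of a word *)

Section MatWord.

Variables (n t : nat) (d h : 'I_t -> nat) (s : n.-tuple 'I_t).
Hypotheses (hn : n = \sum_(i < t) d i) (hs : s \in multiperm n t d).

Let b (j : 'I_t) := \sum_(l < t | l <= j) h l.
Let B := ferrers n t h d.
Let D := block n t d.
Let C := standard_graph d B s.

Lemma partial_sum_mono (w : 'I_t -> nat) (j k : 'I_t) : j <= k ->
  \sum_(l < t | l <= j) w l <= \sum_(l < t | l <= k) w l.
Proof.
move=> jk; rewrite [leqRHS](bigID (fun l : 'I_t => l <= j)) /=.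
rewrite [X in _ <= X + _](eq_bigl (fun l : 'I_t => l <= j)) ?leq_addr //.
by move=> l; rewrite andbC; case: (leqP l j) => //= lj; apply: leq_trans jk.
Qed.

Lemma block_lt (j k : 'I_t) (c c' : 'I_n) :
  c \in D j -> c' \in D k -> j < k -> c < c'.
Proof.
rewrite !inE => /andP[_ cj] /andP[kc _] jk.
apply: leq_trans cj (leq_trans _ kc).
rewrite [leqRHS](bigID (fun l : 'I_t => l <= j)) /=.
rewrite [X in _ <= X + _](eq_bigl (fun l : 'I_t => l <= j)) ?leq_addr //.
by move=> l; rewrite andbC; case: (leqP l j) => //= lj; apply: leq_ltn_trans jk.
Qed.

Let D_inj j k (c : 'I_n) : c \in D j -> c \in D k -> j = k.
Proof.
move=> cj ck; apply: val_inj; case: (ltngtP j k) => // lt.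
  by have := block_lt cj ck lt; rewrite ltnn.
by have := block_lt ck cj lt; rewrite ltnn.
Qed.

Let C_std : is_standard_graph d B s C.
Proof. exact: standard_graphP. Qed.

Let C_graph : exists2 col : 'I_n -> 'I_n,
  injective col & forall x, (x \in C) = (x.2 == col x.1).
Proof.
have /and3P[/andP[/forall_inP natt /eqP cardC] _ _] := C_std.
have inj1 : {in C &, injective fst}.
  move=> x y xC yC e; apply/eqP; apply: contraT => ne.
  by have /forall_inP/(_ y yC) := natt x xC; rewrite ne e eqxx.
have inj2 : {in C &, injective snd}.
  move=> x y xC yC e; apply/eqP; apply: contraT => ne.
  by have /forall_inP/(_ y yC) := natt x xC; rewrite ne e eqxx andbF.
have ex_col i : exists c, (i, c) \in C.
  have : i \in fst @: C.
    suff -> : fst @: C = setT by [].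
    by apply/eqP; rewrite eqEcard subsetT cardsT card_ord (card_in_imset inj1) cardC leqnn.
  by case/imsetP=> -[r c] rcC /= ->; exists c.
pose col i := xchoose (ex_col i).
have colC i : (i, col i) \in C by exact: (xchooseP (ex_col i)).
exists col => [i j e|[r c]].
  by have [] := inj2 _ _ (colC i) (colC j) e.
apply/idP/eqP => /= [rcC|->]; last exact: colC.
by have [] := inj1 _ _ rcC (colC r) erefl.
Qed.

(** By [mat_pairsE]: for different blocks the on/off cases are compared; within a block,
    standardness forces both squares of a pair of rooks to be crossed, so the pair contributes
    nothing. *)
Lemma mat_word_weight : mat_word d B s = (mat_weight b (tnth s))%:Z%R.
Proof.
have [col col_inj in_C] := C_graph.
have /and3P[_ /forall_inP blk /forallP std] := C_std.
have colC i : (i, col i) \in C by rewrite in_C.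
have colD i : col i \in D (tnth s i) by apply: (blk (i, col i)).
have colDE i j : (col i \in D j) = (tnth s i == j).
  by apply/idP/eqP => [|<-//]; apply: D_inj.
have in_B i j : ((i, col j) \in B) = (i < b (tnth s j)).
  rewrite inE; apply/existsP/idP => [[k /andP[/= kD]]|lt].
    by rewrite (D_inj (colD j) kD).
  by exists (tnth s j); rewrite /= colD.
have b_mono (j k : 'I_t) : j <= k -> b j <= b k by apply: partial_sum_mono.
rewrite /mat_word -/C (@mat_pairsE _ C B col (fun j => b (tnth s j)) col_inj in_C in_B
  (fun i j => (tnth s j < tnth s i) && mat_pair b (tnth s j) (tnth s i) j i)).
- by rewrite exchange_big.
- by move=> i; rewrite ltnn.
move=> i j lt; set si := tnth s i; set sj := tnth s j.
(* Hence only the ordered pair [(j, i)] can count, and only if [sj < si]. *)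
have le : sj <= si.
  rewrite leqNgt; apply/negP=> /(block_lt (colD i) (colD j)) lt'.
  by have := ltn_trans lt lt'; rewrite ltnn.
have ne_ij : i != j :> nat by apply: contraTneq lt => /val_inj->; rewrite ltnn.
have := b_mono _ _ le; rewrite [si < sj]ltnNge le /=.
case: (ltnP sj si) => [_|ge] ble /=.
  by rewrite /mat_pair /cyc_after;
     case: (ltnP j (b sj)); case: (ltnP i (b si)) => /=; lia.
have {ge le ble}E : sj = si by apply: val_inj; apply/eqP; rewrite eqn_leq le.
rewrite E.
have /and3P[/forall_inP c1 /forall_inP c2 /forall_inP c3] := std si.
have c_on i' j' : tnth s i' = si -> tnth s j' = si -> i' < b si -> j' < b si ->
    i' < j' -> col j' < col i'.
  move=> ei ej oi oj ij; have := c3 (i', col i').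
  rewrite inE colC colDE ei eqxx in_B ei oi => /(_ isT)/forall_inP/(_ (j', col j')).
  by rewrite inE colC colDE ej eqxx in_B ej oj /= ij; apply.
have c_off i' j' : tnth s i' = si -> tnth s j' = si -> b si <= i' -> b si <= j' ->
    i' < j' -> col i' < col j'.
  move=> ei ej oi oj ij; have := c2 (i', col i').
  rewrite inE colC colDE ei eqxx in_B ei -leqNgt oi.
  move=> /(_ isT)/forall_inP/(_ (j', col j')).
  by rewrite inE colC colDE ej eqxx in_B ej -leqNgt oj /= ij; apply.
(* Off rooks fill the left-most columns of the block, so no on rook lies to the left of an off
   rook. *)
have c_left : (j < b si) && (b si <= i) = false.
  apply/negP=> /andP[jon ioff].
  pose R := [set r | tnth s r == si]; pose on := [set r in R | r < b si].
  pose off := [set r in R | b si <= r].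
  (* This turns the bound of [D_standard], block size minus on rooks, into [#|off|]. *)
  have cardR : #|D si| = #|on| + #|off|.
    have -> : #|on| + #|off| = #|R|.
      rewrite -[RHS](cardsID [set r : 'I_n | r < b si]).
      by congr (_ + _); apply: eq_card => r; rewrite !inE -?leqNgt // andbC.
    rewrite -(card_imset _ col_inj); apply: eq_card => c.
    apply/idP/imsetP => [cD|[r]]; last by rewrite inE -colDE => rD ->.
    have [g gK Kg] := injF_bij col_inj.
    by exists (g c); rewrite ?Kg // inE -colDE Kg.
  have iR : i \in off by rewrite !inE eqxx.
  (* All off columns lie at or left of that of the rightmost off rook [m], as
     does [col j]: so [m] is not among the #|off| left-most columns. *)
  have [m moff mmax] : exists2 m, m \in off & forall r, r \in off -> col r <= col m.
    by case: (arg_maxnP (fun r => col r : nat) iR) => m; exists m.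
  have ms : tnth s m = si by move: moff; rewrite !inE => /andP[/eqP].
  have mb : b si <= m by move: moff; rewrite !inE => /andP[].
  have := c1 (m, col m); rewrite inE colC colDE ms eqxx in_B ms -leqNgt mb.
  move=> /(_ isT) /=; rewrite -/(D si) cardR.
  have -> : #|[set x in C | (x.2 \in D si) && (x \in B)]| = #|on|.
    have gi : injective (fun r => (r, col r)) by move=> r r' [].
    rewrite -(card_imset _ gi); apply: eq_card => -[r c].
    apply/idP/imsetP => [|[r' r'on [-> ->]]].
      rewrite in_set => /and3P[/=]; rewrite in_C => /eqP /= -> rD rB; exists r => //.
      by move: rD rB; rewrite colDE in_B !inE => /eqP-> ->; rewrite eqxx.
    have /andP[/eqP r's r'b] : (tnth s r' == si) && (r' < b si).
      by move: r'on; rewrite !inE.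
    by rewrite in_set colC colDE /= in_B r's eqxx r'b.
  rewrite addKn ltnNge => /negP; apply.
  have joff : j \notin off :\ m by rewrite !inE leqNgt jon !andbF.
  have -> : #|off| = #|j |: (off :\ m)|.
    by rewrite cardsU1 joff (cardsD1 m off) moff.
  rewrite -(card_imset _ col_inj); apply: subset_leq_card.
  apply/subsetP=> _ /imsetP[r + ->]; rewrite in_setU1 [in X in _ -> X]in_set.
  case/orP=> [/eqP->|/setD1P[rm roff]].
    rewrite colDE -/sj E eqxx; exact: leq_trans lt (mmax _ iR).
  rewrite colDE ltn_neqAle mmax // andbT.
  rewrite (inj_eq val_inj) (inj_eq col_inj) rm andbT.
  by move: roff; rewrite !inE => /andP[].
(* It remains that [(i, col j)] is crossed: [i < j] if both rooks are on, [j < i] if both are off,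
   and [i < b si <= j] if only [i] is on. *)
have := c_on i j erefl E; have := c_on j i E erefl.
have := c_off i j erefl E; have := c_off j i E erefl.
move: c_left; case: (ltnP j (b si)); case: (ltnP i (b si)) => //=; lia.
Qed.

End MatWord.

Theorem theorem3 (t n : nat) (d h : 'I_t -> nat)
    (ht : 0 < t)
    (hd : forall i, 0 < d i)
    (hn : n = \sum_(i < t) d i)
    (hh : \sum_(i < t) h i <= n) :
  (\sum_(s in multiperm n t d) qvar ^ (mat_word d (ferrers n t h d) s)
   = qfact n / \prod_(i < t) qfact (d i))%R.
Proof.
pose b (j : 'I_t) := \sum_(l < t | l <= j) h l.
have b_mono (j k : 'I_t) : j <= k -> b j <= b k by apply: partial_sum_mono.
transitivity (\sum_(f : {ffun 'I_n -> 'I_t} | counted d f) qvar ^+ mat_weight b f)%R.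
  pose word (f : {ffun 'I_n -> 'I_t}) := [tuple f i | i < n].
  rewrite (reindex word) /=; last first.
    exists (fun s => [ffun i => tnth s i]) => [f _|s _].
      by apply/ffunP=> i; rewrite ffunE tnth_mktuple.
    by apply: eq_from_tnth => i; rewrite tnth_mktuple ffunE.
  have wordP f : (word f \in multiperm n t d) = counted d f.
    rewrite inE; apply: eq_forallb => l; congr (_ == _).
    rewrite count_map val_ord_tuple -size_filter cardE enumT; congr size.
    by apply: eq_filter => i; rewrite !inE.
  apply: eq_big => [f|f fM]; first exact: wordP.
  rewrite (mat_word_weight _ hn) // -/b; congr (_ ^+ _)%R.
  by apply: eq_bigr => x _; apply: eq_bigr => y _; rewrite !tnth_mktuple.
rewrite (sum_mat_cyc _ _ _ b_mono).
(* Any word can serve as the reference [g] of [sum_cyc]; [0 < t] provides a letter for it. *)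
have i0 : 'I_t by exists 0.
rewrite (sum_cyc _ _ _ (fun=> i0)).
have prod_rev (F : 'I_t -> {fraction {poly rat}}) :
    (\prod_(l <- rev (enum 'I_t)) F l = \prod_(i < t) F i)%R.
  by rewrite (perm_big _ (permEl (perm_rev _))) big_enum.
have prod_neq0 : (\prod_(i < t) qfact (d i) != 0)%R.
  by apply/prodf_neq0 => i _; apply: qfact_neq0.
apply: (mulIf prod_neq0); rewrite (divfK prod_neq0) -prod_rev word_gf_fact //.
by rewrite (perm_big _ (permEl (perm_rev _))) big_enum.
Qed.
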